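(* Let $\mathcal{B}$ be a swap structure for $\mathbf{LFI1}_\circ$. Then there exist a set $I$ and a monomorphism of algebras $\hat h:\mathcal{B}\to\prod_{i\in I}\mathcal{B}_{\mathbb{A}_2}^{\mathbf{LFI1}_\circ}$.
   Context: Let $\Sigma=\{\wedge,\vee,\to,\neg,\circ\}$, with $\wedge,\vee,\to$ binary and $\neg,\circ$ unary. For a Boolean algebra $\mathcal{A}$ with domain $A$ (the one-element Boolean algebra is allowed), with complement $\sim$, put $\mathrm{B}_{\mathcal{A}}^{\mathbf{ciw}}=\{(z_1,z_2)\in A^2 : z_1\vee z_2=1\}$. A swap structure for $\mathbf{LFI1}_\circ$ over $\mathcal{A}$ is a multialgebra over $\Sigma$ (a set with operations whose values are nonempty subsets) with domain $B\subseteq\mathrm{B}_{\mathcal{A}}^{\mathbf{ciw}}$, such that $0\in\{z_1:(z_1,z_2)\in B\}$, whose multioperations are single-valued and given, for all $(z_1,z_2),(w_1,w_2)\in B$, by - $(z_1,z_2)\wedge(w_1,w_2)=\{(z_1\wedge w_1,\ z_2\vee w_2)\}$; - $(z_1,z_2)\vee(w_1,w_2)=\{(z_1\vee w_1,\ z_2\wedge w_2)\}$; - $(z_1,z_2)\to(w_1,w_2)=\{(z_1\to w_1,\ z_1\wedge w_2)\}$; - $\neg(z_1,z_2)=\{(z_2,z_1)\}$; - $\circ(z_1,z_2)=\{({\sim}(z_1\wedge z_2),\ z_1\wedge z_2)\}$. Being single-valued, such structures are regarded as ordinary algebras over $\Sigma$ (identifying a singleton with its element); monomorphisms of algebras are injective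 homomorphisms, and products are direct products. A swap structure for $\mathbf{LFI1}_\circ$ is one over some Boolean algebra $\mathcal{A}$, and $\mathcal{B}_{\mathcal{A}}^{\mathbf{LFI1}_\circ}$ denotes the one with full domain $\mathrm{B}_{\mathcal{A}}^{\mathbf{ciw}}$. $\mathbb{A}_2$ is the two-element Boolean algebra (so $\mathcal{B}_{\mathbb{A}_2}^{\mathbf{LFI1}_\circ}$ has the three elements $(1,0),(1,1),(0,1)$). *)

(* Defs.v *)
From mathcomp Require Import all_boot all_order.
From mathcomp Require Import boolp classical_sets.

Set Implicit Arguments.
Unset Strict Implicit.
Unset Printing Implicit Defensive.

Import Order.Theory.
Local Open Scope classical_set_scope.

Variant binsym := And | Or | Imp.
Variant unsym := Neg | Circ.

Record multialgebra (T : Type) := Multialgebra {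
  mop2 : binsym -> T -> T -> set T;
  mop1 : unsym -> T -> set T;
  mop2_neq0 : forall s x y, mop2 s x y !=set0;
  mop1_neq0 : forall s x, mop1 s x !=set0
}.

Record algebra (T : Type) := Algebra {
  op2 : binsym -> T -> T -> T;
  op1 : unsym -> T -> T
}.

Definition single_valued (T : Type) (M : multialgebra T) : Prop :=
  (forall s x y, exists z, mop2 M s x y = [set z]) /\
  (forall s x, exists z, mop1 M s x = [set z]).

(* Identification of each singleton value with its element. *)
Definition algebra_of (T : Type) (M : multialgebra T) (sv : single_valued M) :
    algebra T :=
  Algebra (fun s x y => projT1 (cid (sv.1 s x y)))
          (fun s x => projT1 (cid (sv.2 s x))).

Definition homomorphism (T U : Type) (a : algebra T) (b : algebra U)
    (h : T -> U) : Prop :=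
  (forall s x y, h (op2 a s x y) = op2 b s (h x) (h y)) /\
  (forall s x, h (op1 a s x) = op1 b s (h x)).

Definition monomorphism (T U : Type) (a : algebra T) (b : algebra U)
    (h : T -> U) : Prop :=
  homomorphism a b h /\ injective h.

Definition product (I : Type) (T : I -> Type) (a : forall i, algebra (T i)) :
    algebra (forall i, T i) :=
  Algebra (fun s x y i => op2 (a i) s (x i) (y i))
          (fun s x i => op1 (a i) s (x i)).

(* Boolean algebras are the ctbDistrLatticeType's; these may have \bot = \top. *)
Section SwapStructures.
Context (d : Order.disp_t) (A : ctbDistrLatticeType d).

Definition ciw : set (A * A) := [set z | (z.1 `|` z.2 = \top)%O].

Definition swap2 (s : binsym) (z w : A * A) : A * A :=
  match s with
  | And => (z.1 `&` w.1, z.2 `|` w.2)%O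
  | Or => (z.1 `|` w.1, z.2 `&` w.2)%O
  | Imp => (~` z.1 `|` w.1, z.1 `&` w.2)%O
  end.

Definition swap1 (s : unsym) (z : A * A) : A * A :=
  match s with
  | Neg => (z.2, z.1)
  | Circ => (~` (z.1 `&` z.2), z.1 `&` z.2)%O
  end.

Record swap_structure := SwapStructure {
  sdom : set (A * A);
  sdom_ciw : sdom `<=` ciw;
  sdom_bot : [set z.1 | z in sdom] (\bot)%O;
  smulti : multialgebra (set_type sdom);
  smop2E : forall s z w,
    val @` mop2 smulti s z w = [set swap2 s (val z) (val w)];
  smop1E : forall s z,
    val @` mop1 smulti s z = [set swap1 s (val z)]
}.

Lemma image_val_set1 (D : set (A * A)) (X : set (set_type D)) (v : A * A) :
  val @` X = [set v] -> exists z, X = [set z].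
Proof.
move=> XE; have [z Xz zv] : (val @` X) v by rewrite XE.
exists z; apply/seteqP; split=> [u Xu|_ ->//].
have : (val @` X) (val u) by exists u.
by rewrite XE /= -zv => /val_inj.
Qed.

Lemma smulti_single_valued (B : swap_structure) : single_valued (smulti B).
Proof.
split=> [s z w|s z]; first exact: image_val_set1 (smop2E s z w).
exact: image_val_set1 (smop1E s z).
Qed.

Definition swap_algebra (B : swap_structure) : algebra (set_type (sdom B)) :=
  algebra_of (smulti_single_valued B).

Lemma swap2_ciw s z w : ciw z -> ciw w -> ciw (swap2 s z w).
Proof.
rewrite /ciw /= => zT wT; case: s => /=.
- by rewrite joinIl joinA zT joinCA wT joinx1 join1x meetxx.
- rewrite joinIr [X in (X `&` _)%O]joinAC zT join1x.
  by rewrite -joinA wT joinx1 meetxx.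
- rewrite joinIr -[X in (_ `&` X)%O]joinA wT joinx1 meetx1.
  by rewrite joinAC joinCx join1x.
Qed.

Lemma swap1_ciw s z : ciw z -> ciw (swap1 s z).
Proof. by rewrite /ciw /=; case: s => /= zT; [rewrite joinC|rewrite joinC joinxC]. Qed.

Definition full_mop2 (s : binsym) (z w : set_type ciw) : set (set_type ciw) :=
  [set u | val u = swap2 s (val z) (val w)].

Definition full_mop1 (s : unsym) (z : set_type ciw) : set (set_type ciw) :=
  [set u | val u = swap1 s (val z)].

Lemma full_mop2E s z w :
  val @` full_mop2 s z w = [set swap2 s (val z) (val w)].
Proof.
apply/seteqP; split=> [_ [u uE <-]//|_ ->].
by exists (SigSub (mem_set (swap2_ciw s (set_valP z) (set_valP w)))).
Qed.

Lemma full_mop1E s z : val @` full_mop1 s z = [set swap1 s (val z)].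
Proof.
apply/seteqP; split=> [_ [u uE <-]//|_ ->].
by exists (SigSub (mem_set (swap1_ciw s (set_valP z)))).
Qed.

Lemma full_mop2_neq0 s z w : full_mop2 s z w !=set0.
Proof. by have [u ->] := image_val_set1 (full_mop2E s z w); exists u. Qed.

Lemma full_mop1_neq0 s z : full_mop1 s z !=set0.
Proof. by have [u ->] := image_val_set1 (full_mop1E s z); exists u. Qed.

Lemma ciw_bot : [set z.1 | z in ciw] (\bot)%O.
Proof. by exists (\bot, \top)%O => //=; rewrite /ciw /= joinx1. Qed.

Definition full_swap : swap_structure :=
  SwapStructure (@subset_refl _ ciw) ciw_bot
    (smulti := Multialgebra full_mop2_neq0 full_mop1_neq0)
    full_mop2E full_mop1E.

End SwapStructures.

Arguments ciw {d} A.
Arguments full_swap {d} A.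

(* Main.v *)
Require Import Defs.
From mathcomp Require Import all_boot all_order.
From mathcomp Require Import boolp classical_sets.

(* By Zorn's lemma, every c != \bot belongs to an ultrafilter, so the Boolean
   morphisms A -> bool separate the elements of A. Applying such a morphism to both components of a
   pair commutes with the swap operations, so the family of all of them is a
   homomorphism into a power of the three-element structure, and it is
   injective by separation. *)

Set Implicit Arguments.
Unset Strict Implicit.
Unset Printing Implicit Defensive.

Import Order.Theory.
Local Open Scope classical_set_scope.
Local Open Scope order_scope.

Section BooleanMorphism.
Context (d d' : Order.disp_t) (A : ctbDistrLatticeType d)
  (C : ctbDistrLatticeType d').

(** Joins are then preserved by De Morgan, and [\top] because it is the join of an element with its
    complement. *)
Definition boolean_morphism (f : A -> C) : Prop :=
  {morph f : x y / x `&` y} /\ {morph f : x / ~` x}.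

Context (f : A -> C) (fM : boolean_morphism f).

Lemma boolean_morphismU : {morph f : x y / x `|` y}.
Proof. by move=> x y; rewrite -[x `|` y]complK complU !(fM.1, fM.2) complI !complK. Qed.

Lemma boolean_morphism1 : f \top = \top.
Proof. by rewrite -(joinxC \top) boolean_morphismU fM.2 joinxC. Qed.

Definition map_pair (z : A * A) : C * C := (f z.1, f z.2).

Lemma map_pair_ciw z : ciw A z -> ciw C (map_pair z).
Proof. by rewrite /ciw /= => zT; rewrite -boolean_morphismU zT boolean_morphism1. Qed.

Lemma map_pair_swap2 s z w :
  map_pair (swap2 s z w) = swap2 s (map_pair z) (map_pair w).
Proof. by case: s; rewrite /map_pair /= !(fM.1, fM.2, boolean_morphismU). Qed.

Lemma map_pair_swap1 s z : map_pair (swap1 s z) = swap1 s (map_pair z).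
Proof. by case: s; rewrite /map_pair /= ?(fM.1, fM.2). Qed.

End BooleanMorphism.

Section Ultrafilter.
Context (d : Order.disp_t) (A : ctbDistrLatticeType d) (c : A).

(* The empty set qualifies, so that Zorn's lemma needs no nonempty chain. *)
Definition filter_meeting (F : set A) : Prop :=
  [/\ forall x y, F x -> x <= y -> F y,
      forall x y, F x -> F y -> F (x `&` y) &
      forall x, F x -> c `&` x != \bot].

(** The union of a chain stays in the class: any two of its elements already lie in a common member
    of the chain. *)
Lemma maximal_filter_meeting :
  exists M, filter_meeting M /\ forall F, M `<` F -> ~ filter_meeting F.
Proof.
apply: Zorn_bigcup => K KP Ktot; split.
- by move=> x y [F KF Fx] xy; exists F => //; have [up _ _] := KP _ KF; apply: up xy.
- move=> x y [F KF Fx] [G KG Gy]; have [FG|GF] := Ktot _ _ KF KG.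
    by exists G => //; have [_ I _] := KP _ KG; apply: I => //; apply: FG.
  by exists F => //; have [_ I _] := KP _ KF; apply: I => //; apply: GF.
- by move=> x [F KF Fx]; have [_ _] := KP _ KF; apply.
Qed.

Context (M : set A) (MP : filter_meeting M)
  (Mmax : forall F, M `<` F -> ~ filter_meeting F).

Lemma maximal_filter_meeting_notin x :
  ~ M x -> exists2 y, y = \top \/ M y & c `&` y <= ~` x.
Proof.
have [Mup MI Mc] := MP => Mx; apply: contrapT => Nx.
(* The filter generated by [M] and [x]; allowing [y = \top] puts [x] in [F] even when [M] is empty.
   By maximality, [F] must contain an element disjoint from [c]. *)
pose F := [set z | exists2 y, y = \top \/ M y & y `&` x <= z].
apply: (Mmax (F := F)).
  split; last by move=> /(_ x)/= FM; apply/Mx/FM; exists \top; [left|rewrite meet1x].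
  by move=> z Mz; exists z; [right|exact: leIl].
split.
- by move=> u v [y My yu] uv; exists y => //; apply: le_trans uv.
- move=> u v [y My yu] [z Mz zv]; exists (y `&` z).
    case: My => [->|My]; first by rewrite meet1x.
    by case: Mz => [->|Mz]; [rewrite meetx1|]; right => //; apply: MI.
  by rewrite -[x in _ `&` x]meetxx meetACA leI2.
- move=> z [y My yz]; apply/eqP => cz; apply: Nx; exists y => //.
  by rewrite -disj_leC -lex0 -meetA -cz leI2.
Qed.

Context (c_neq0 : c != \bot).

(** If both failed, there would be [y] and [z], each [\top] or in [M], with [c] meet [y] below the
    complement of [x] and [c] meet [z] below [x]. Then [c] would be disjoint from [y] meet [z],
    which is [\top] or in [M]. *)
Lemma maximal_filter_meeting_compl x : M x \/ M (~` x).
Proof.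
have [Mup MI Mc] := MP; apply: contrapT => /not_orP[].
move=> /maximal_filter_meeting_notin[y My cyx].
move=> /maximal_filter_meeting_notin[z Mz]; rewrite complK => czx.
have : c `&` (y `&` z) = \bot.
  by apply/eqP; rewrite -lex0 -(meetxC x) -[c]meetxx meetACA [x `&` _]meetC leI2.
case: My Mz => [->|My] [->|Mz]; rewrite ?meet1x ?meetx1 => c0.
- by move: c_neq0; rewrite c0 eqxx.
- by move: (Mc _ Mz); rewrite c0 eqxx.
- by move: (Mc _ My); rewrite c0 eqxx.
- by move: (Mc _ (MI _ _ My Mz)); rewrite c0 eqxx.
Qed.

Lemma maximal_filter_meeting_mem : M c.
Proof.
have [Mup MI Mc] := MP.
by case: (maximal_filter_meeting_compl c) => // /Mc; rewrite meetxC eqxx.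
Qed.

(** Complements are preserved because [M] contains exactly one of [x] and its complement: with both
    it would contain [\bot], which does not meet [c]. *)
Lemma maximal_filter_meeting_morphism :
  boolean_morphism (fun x => `[< M x >] : bool).
Proof.
have [Mup MI Mc] := MP; split=> [x y|x] /=.
  rewrite [RHS]/Order.meet /= -asbool_and; apply: asbool_equiv_eq.
  by split=> [Mxy|[]//]; [split; apply: Mup Mxy _; [exact: leIl|exact: leIr]|exact: MI].
rewrite [RHS]/Order.compl /= -asbool_neg; apply: asbool_equiv_eq.
split=> [MNx Mx|]; last by case: (maximal_filter_meeting_compl x).
by move: (Mc _ (MI _ _ Mx MNx)); rewrite meetxC meetx0 eqxx.
Qed.

End Ultrafilter.

Lemma boolean_morphism_separation (d : Order.disp_t)
    (A : ctbDistrLatticeType d) (a b : A) :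
  (forall f : A -> bool, boolean_morphism f -> f a = f b) -> a = b.
Proof.
(* The hypothesis is symmetric in [a] and [b], so one inequality suffices. *)
wlog suff le : a b / (forall f : A -> bool, boolean_morphism f -> f a = f b) -> a <= b.
  by move=> ab; apply/le_anti/andP; split; apply: le => // f /ab.
move=> ab; rewrite -[b]complK -disj_leC; apply: contrapT => /negP c0.
(* The indicator of [M] is true at this element, yet its value there is [f b] meet its own
   complement, since [f a = f b]. *)
have [M [MP Mmax]] := maximal_filter_meeting (a `&` ~` b).
have [fI fC] := maximal_filter_meeting_morphism MP Mmax c0.
have /asboolT := maximal_filter_meeting_mem MP Mmax c0.
by rewrite fI fC (ab _ (conj fI fC)) meetxC.
Qed.

(** The element chosen by [cid] is the only one in the value of the multioperation, so the swap
    formula determines it. *)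
Lemma swap_op2E (d : Order.disp_t) (A : ctbDistrLatticeType d)
    (B : swap_structure A) s (z w : set_type (sdom B)) :
  val (op2 (swap_algebra B) s z w) = swap2 s (val z) (val w).
Proof.
rewrite /=; case: cid => u /= uE.
by have := smop2E s z w; rewrite uE image_set1 => /seteqP[/(_ _ erefl)].
Qed.

Lemma swap_op1E (d : Order.disp_t) (A : ctbDistrLatticeType d)
    (B : swap_structure A) s (z : set_type (sdom B)) :
  val (op1 (swap_algebra B) s z) = swap1 s (val z).
Proof.
rewrite /=; case: cid => u /= uE.
by have := smop1E s z; rewrite uE image_set1 => /seteqP[/(_ _ erefl)].
Qed.

(* bool is the two-element Boolean algebra. *)
Theorem theorem9p12 (d : Order.disp_t) (A : ctbDistrLatticeType d)
    (B : swap_structure A) :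
  exists (I : Type)
         (h : set_type (sdom B) -> (I -> set_type (sdom (full_swap bool)))),
    monomorphism (swap_algebra B)
                 (product (fun _ : I => swap_algebra (full_swap bool)))
                 h.
Proof.
(* If [\bot = \top] in [A], this index type is empty and the product is a single point. *)
exists {f : A -> bool | boolean_morphism f}.
exists (fun z f => SigSub (mem_set
  (map_pair_ciw (svalP f) (sdom_ciw (set_valP z))))).
split; first split.
- move=> s z w; apply: functional_extensionality_dep => f; apply: val_inj.
  apply: etrans (congr1 (map_pair (sval f)) (swap_op2E _ _ _)) _.
  by rewrite (map_pair_swap2 (svalP f)); exact/esym/swap_op2E.
- move=> s z; apply: functional_extensionality_dep => f; apply: val_inj.
  apply: etrans (congr1 (map_pair (sval f)) (swap_op1E _ _)) _.
  by rewrite (map_pair_swap1 (svalP f)); exact/esym/swap_op1E.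
move=> z w zw; apply: val_inj.
(* Reading the equality of families at the index [f] gives both components, to which separation
   applies. *)
have zwf (f : A -> bool) (fM : boolean_morphism f) :
    map_pair f (val z) = map_pair f (val w).
  by have /(congr1 val) := congr1 (@^~ (exist _ f fM)) zw.
rewrite [LHS]surjective_pairing [RHS]surjective_pairing.
by congr pair; apply: boolean_morphism_separation => f /zwf[].
Qed.
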